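(* Let $G$ be a partial cube and let $\{F_1,\ldots,F_k\}$ be a partition of $E(G)$ coarser than the $\Theta$-partition. Then $$Sz(G)=\sum_{i=1}^k Sz(G/F_i,w_i,w_i').$$
   Context: All graphs are finite, simple and connected; $d_G$ denotes shortest-path distance. A partial cube is a graph isomorphic to an isometric (distance-preserving) subgraph of a hypercube. Edges $u_1v_1,u_2v_2$ are in relation $\Theta$ if $d_G(u_1,u_2)+d_G(v_1,v_2)\neq d_G(u_1,v_2)+d_G(v_1,u_2)$; in a partial cube $\Theta$ is an equivalence relation whose classes form the $\Theta$-partition of $E(G)$. A partition $\{F_1,\ldots,F_k\}$ of $E(G)$ is coarser than the $\Theta$-partition if each $F_i$ is a union of $\Theta$-classes. For $F\subseteq E(G)$, $G/F$ is the graph whose vertices are the vertex sets of the connected components of $G-F$, two distinct components being adjacent iff some vertex of one is adjacent in $G$ to some vertex of the other. Weights: $w_i(x)$ is the number of vertices of the component $x\in V(G/F_i)$; $w_i'(xy)$ is the number of edges of $F_i$ with one end-vertex in $x$ and the other in $y$. For an edge $e=uv$ of a graph $H$: $N_1(e|H)=\{z: d_H(z,u)<d_H(z,v)\}$, $N_2(e|H)=\{z: d_H(z,v)<d_H(z,u)\}$, $n_s(e|H)=|N_s(e|H)|$. The Szeged index is $Sz(H)=\sum_{e\in E(H)}n_1(e|H)n_2(e|H)$. For $w:V(H)\to\mathbb{R}^+$, $w':E(H)\to\mathbb{R}^+$, let $n_s(e|(H,w))=\sum_{z\in N_s(e|H)}w(z)$ and $Sz(H,w,w')=\sum_{e\in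 E(H)}w'(e)\,n_1(e|(H,w))\,n_2(e|(H,w))$. *)

(* Defs.v *)
From HB Require Import structures.
From mathcomp Require Import all_boot all_order all_algebra.

Set Implicit Arguments.
Unset Strict Implicit.
Unset Printing Implicit Defensive.

Import GRing.Theory Num.Theory.

Record sgraph := SGraph {
  vertex :> finType;
  adj : rel vertex;
  adj_sym : symmetric adj;
  adj_irrefl : irreflexive adj }.

Arguments adj {s} : rename.

Definition connected (G : sgraph) : Prop := forall x y : G, connect adj x y.

(* As iota 0 n lists 0, 1, ..., find returns the least length of a path from  *)
(* x to y; a shortest path has fewer than #|T| edges. The value is #|T| when  *)
(* y is not reachable from x.                                                 *)
Definition dist (T : finType) (e : rel T) (x y : T) : nat :=
  find (fun n => [exists p : n.-tuple T, path e x p && (last x p == y)])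
       (iota 0 #|T|).

Definition edges (G : sgraph) : {set {set G}} :=
  [set [set p.1; p.2] | p : G * G & adj p.1 p.2].

Section Hypercube.
Variable n : nat.

Definition hcube_adj : rel {ffun 'I_n -> bool} :=
  fun x y => #|[set i | x i != y i]| == 1.

Lemma hcube_adj_sym : symmetric hcube_adj.
Proof.
move=> x y; rewrite /hcube_adj; congr (_ == _).
by apply: eq_card => i; rewrite !inE eq_sym.
Qed.

Lemma hcube_adj_irrefl : irreflexive hcube_adj.
Proof.
move=> x; rewrite /hcube_adj (_ : [set i | _] = set0) ?cards0 //.
by apply/setP => i; rewrite !inE eqxx.
Qed.

Definition hypercube : sgraph := SGraph hcube_adj_sym hcube_adj_irrefl.

End Hypercube.

(* (S, a) is a subgraph of K with vertex set S and adjacency a, not assumed   *)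
(* to be induced.                                                             *)
Definition isometric_subgraph (K : sgraph) (S : {set K})
    (a : rel {x : K | x \in S}) : Prop :=
  [/\ symmetric a,
      forall x y, a x y -> adj (val x) (val y) &
      forall x y, dist a x y = dist adj (val x) (val y)].

Definition isomorphism (T U : finType) (a : rel T) (b : rel U) (f : T -> U) :
    Prop :=
  bijective f /\ forall x y, b (f x) (f y) = a x y.

Definition partial_cube (G : sgraph) : Prop :=
  exists (n : nat) (S : {set hypercube n}) (a : rel {x | x \in S}),
    isometric_subgraph a /\ exists f, isomorphism (@adj G) a f.

(* The inequality does not depend on how the ends of e and f are labelled.    *)
Definition Theta (G : sgraph) : rel {set G} := fun e f =>
  [exists u1 : G, exists v1 : G, exists u2 : G, exists v2 : G,
    [&& e == [set u1; v1], f == [set u2; v2] &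
        dist adj u1 u2 + dist adj v1 v2 != dist adj u1 v2 + dist adj v1 u2]].

Definition Theta_partition (G : sgraph) : {set {set {set G}}} :=
  equivalence_partition (@Theta G) (edges G).

Definition coarser (G : sgraph) (P : {set {set {set G}}}) : Prop :=
  forall F, F \in P ->
    exists2 C : {set {set {set G}}}, C \subset Theta_partition G & F = cover C.

Section Quotient.
Variables (G : sgraph) (F : {set {set G}}).

Definition del_edges : rel G := fun x y => adj x y && ([set x; y] \notin F).

Definition components : {set {set G}} :=
  equivalence_partition (connect del_edges) [set: G].

Definition quot_adj : rel {X : {set G} | X \in components} := fun X Y =>
  (X != Y) && [exists x in val X, exists y in val Y, adj x y].

Lemma quot_adj_sym : symmetric quot_adj.
Proof.
move=> X Y; rewrite /quot_adj eq_sym; congr (_ && _).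
by apply/exists_inP/exists_inP => -[x xX /exists_inP[y yY xy]];
  exists y => //; apply/exists_inP; exists x; rewrite // adj_sym.
Qed.

Lemma quot_adj_irrefl : irreflexive quot_adj.
Proof. by move=> X; rewrite /quot_adj eqxx. Qed.

Definition quotient_graph : sgraph := SGraph quot_adj_sym quot_adj_irrefl.

Variable R : numDomainType.

Definition quot_vweight (X : quotient_graph) : R := (#|val X|)%:R.

Definition quot_eweight (a : {set quotient_graph}) : R :=
  (#|[set f in F |
      [exists X : quotient_graph, exists Y : quotient_graph,
        (a == [set X; Y]) &&
        [exists x in val X, exists y in val Y, f == [set x; y]]]]|)%:R.

(* The two weights are positive, as required of vertex- and edge-weights.     *)
Lemma quot_vweight_gt0 (X : quotient_graph) : (0 < quot_vweight X)%R.
Proof.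
rewrite ltr0n card_gt0; apply/set0Pn; case: X => X /= /imsetP[x _ ->].
by exists x; rewrite !inE connect0.
Qed.

Lemma quot_eweight_gt0 (a : {set quotient_graph}) :
  a \in edges quotient_graph -> (0 < quot_eweight a)%R.
Proof.
move=> /imsetP[[X Y]]; rewrite inE /= => /andP[neqXY].
move=> /exists_inP[x xX /exists_inP[y yY xy]] ->.
rewrite ltr0n card_gt0; apply/set0Pn; exists [set x; y]; rewrite inE.
apply/andP; split; last first.
  apply/existsP; exists X; apply/existsP; exists Y; rewrite eqxx /=.
  by apply/exists_inP; exists x => //; apply/exists_inP; exists y.
apply: contraNT neqXY => xyF.
have sym : connect_sym del_edges.
  apply: sym_connect_sym => u v.
  by rewrite /del_edges adj_sym setUC.
have cxy : connect del_edges x y by apply: connect1; rewrite /del_edges xy.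
case: X Y xX yY => [X X_comp] [Y Y_comp] /= xX yY.
rewrite -val_eqE /=.
case/imsetP: X_comp xX => u _ ->; case/imsetP: Y_comp yY => v _ ->.
rewrite !inE => vy ux; apply/eqP/setP => z; rewrite !inE.
apply: (same_connect sym); apply: connect_trans ux _.
by apply: connect_trans cxy _; rewrite sym.
Qed.

End Quotient.

Section Szeged.
Variable H : sgraph.

Definition N1 (e : H * H) : {set H} :=
  [set z | dist adj z e.1 < dist adj z e.2].

Definition N2 (e : H * H) : {set H} :=
  [set z | dist adj z e.2 < dist adj z e.1].

(* Each edge occurs exactly once, as e = uv with its ends in a fixed order;   *)
(* swapping the ends swaps N1 and N2, so the sums below do not depend on it.  *)
Definition oriented_edges : {set H * H} :=
  [set e | adj e.1 e.2 && (enum_rank e.1 < enum_rank e.2)].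

Definition Sz : nat := \sum_(e in oriented_edges) #|N1 e| * #|N2 e|.

Definition wSz (R : numDomainType) (w : H -> R) (w' : {set H} -> R) : R :=
  (\sum_(e in oriented_edges)
     w' [set e.1; e.2] * (\sum_(z in N1 e) w z) * (\sum_(z in N2 e) w z))%R.

End Szeged.

(* Main.v *)
Require Import Defs.
From mathcomp Require Import all_boot all_order all_algebra.

(* An isometric embedding into a hypercube labels each edge by the coordinate *)
(* it flips, and Theta-related edges are those with equal labels. A block F   *)
(* is thus given by a set I of labels, and two vertices lie in the same       *)
(* component of G - F iff they agree on I, since a geodesic flips no          *)
(* coordinate twice. So projection to I embeds G/F isometrically, and for an  *)
(* edge xy of F with label i, both N1(xy) in G and N1 of the image of xy in   *)
(* G/F are cut out by the value of coordinate i; the two have the same        *)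
(* (weighted) size. Sums run over ordered pairs, which doubles both sides.    *)

Set Implicit Arguments.
Unset Strict Implicit.
Unset Printing Implicit Defensive.

Import GRing.Theory Num.Theory.

(** An edge of G contributes to Sz(G) the product of the sizes of the two halves into which its
    coordinate cuts G. [Theta_sep] turns coarseness into closure of F under equal coordinates.
    [connect_del_edges] and [dist_quot] then describe G/F and its metric by the coordinates of F
    alone, and [mem_N1_cpnt] shows that the halves cut by an edge of F are unions of components.
    Hence, by [double_wSz_quot], the summand of F is exactly the contribution of the edges of F to
    Sz(G), and the blocks exhaust the edges. *)

(** * Distance as the length of a shortest path *)

Section Distance.
Variables (T : finType) (e : rel T).

Lemma uniq_size_lt_card (x : T) (p : seq T) : uniq (x :: p) -> size p < #|T|.
Proof. by move/card_uniqP => /= <-; apply: max_card. Qed.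

(** The search in [dist] stops below [#|T|], so the path is first shortened to one without repeated
    vertices. *)
Lemma dist_le_size (x : T) (p : seq T) :
  path e x p -> dist e x (last x p) <= size p.
Proof.
move=> ep; case: (shortenP ep) => q eq uq sub_qp.
have le_qp : size q <= size p.
  by apply: uniq_leq_size; [case/andP: uq | exact: sub_qp].
apply: leq_trans le_qp; rewrite leqNgt; apply/negP => lt_q.
have q_lt : size q < #|T| by apply: uniq_size_lt_card uq.
have /existsP[] := negbT (before_find 0 lt_q).
rewrite nth_iota // add0n; exists (in_tuple q).
by rewrite eq eqxx.
Qed.

Lemma dist_path (x y : T) : connect e x y ->
  exists p, [/\ path e x p, last x p = y & size p = dist e x y].
Proof.
case/connectP=> p0 ep0 ->; case: (shortenP ep0) => q eq uq _.
have q_lt : size q < #|T| by apply: uniq_size_lt_card uq.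
have hasd : has (fun n => [exists p : n.-tuple T,
    path e x p && (last x p == last x q)]) (iota 0 #|T|).
  apply/hasP; exists (size q); first by rewrite mem_iota.
  by apply/existsP; exists (in_tuple q); rewrite eq eqxx.
have := nth_find 0 hasd; move: (hasd); rewrite has_find size_iota => lt_d.
rewrite nth_iota // add0n => /existsP[p /andP[ep /eqP lp]].
by exists p; rewrite size_tuple.
Qed.

End Distance.

(** * Separating coordinates and Hamming distance *)

Section Separators.
Variable n : nat.
Implicit Types a b c : {ffun 'I_n -> bool}.

Definition sep a b : {set 'I_n} := [set i | a i != b i].

Lemma sepC a b : sep a b = sep b a.
Proof. by apply/setP => i; rewrite !inE eq_sym. Qed.

Lemma sepxx a : sep a a = set0.
Proof. by apply/setP => i; rewrite !inE eqxx. Qed.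

Lemma sep_triangle b a c : sep a c \subset sep a b :|: sep b c.
Proof.
by apply/subsetP => i; rewrite !inE; case: (a i) (b i) (c i) => [] [] [].
Qed.

Lemma sep_eq0 a b : sep a b = set0 -> a = b.
Proof.
move=> s0; apply/ffunP => i; move/setP/(_ i): s0.
by rewrite !inE => /negbFE/eqP.
Qed.

(** The sets [sep c a] and [sep c b] agree off i, so coordinate i alone decides which is smaller. *)
Lemma ltn_card_sep a b c i : sep a b = [set i] ->
  (#|sep c a| < #|sep c b|) = (c i == a i).
Proof.
move=> sab; have abi j : (a j != b j) = (j == i).
  by move/setP/(_ j): sab; rewrite !inE.
rewrite (cardsD1 i (sep c a)) (cardsD1 i (sep c b)).
have -> : sep c b :\ i = sep c a :\ i.
  apply/setP => j; rewrite !inE -abi.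
  by case: (a j) (b j) (c j) => [] [] [].
rewrite ltn_add2r !inE; have := abi i; rewrite eqxx.
by case: (a i) (b i) (c i) => [] [] [].
Qed.

(** Criterion for an isometric embedding, applied to the hypercube, to G and to G/F. Repeatedly
    moving closer gives a path that is short enough; conversely each edge flips one coordinate, so a
    path has at least as many edges as there are coordinates to flip. *)
Lemma dist_sep (T : finType) (e : rel T) (phi : T -> {ffun 'I_n -> bool}) :
    injective phi ->
    (forall x y, e x y -> #|sep (phi x) (phi y)| = 1) ->
    (forall x y, x != y ->
       exists2 z, e x z & #|sep (phi z) (phi y)| < #|sep (phi x) (phi y)|) ->
  forall x y, dist e x y = #|sep (phi x) (phi y)|.
Proof.
move=> phi_inj sep1 step x y.
have [p [ep lp sp]] : exists p,
    [/\ path e x p, last x p = y & size p <= #|sep (phi x) (phi y)|].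
  have [m] := ubnP #|sep (phi x) (phi y)|; elim: m x => // m IHm x lt_m.
  have [<-|neq_xy] := eqVneq x y; first by exists [::].
  have [z xz lt_z] := step _ _ neq_xy.
  have [p [ep lp sp]] := IHm z (leq_trans lt_z lt_m).
  by exists (z :: p); rewrite /= xz ep; split=> //; apply: leq_ltn_trans lt_z.
have lower q z : path e z q -> #|sep (phi z) (phi (last z q))| <= size q.
  elim: q z => [|u q IHq] z /=; first by rewrite sepxx cards0.
  case/andP=> /sep1 zu /IHq uq.
  apply: leq_trans (subset_leq_card (sep_triangle (phi u) _ _)) _.
  by apply: leq_trans (leq_card_setU _ _) _; rewrite zu.
apply/eqP; rewrite eqn_leq; apply/andP; split.
  by apply: leq_trans sp; rewrite -lp; apply: dist_le_size.
have cxy : connect e x y by apply/connectP; exists p.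
by have [q [eq <- <-]] := dist_path cxy; apply: lower.
Qed.

End Separators.

(** * Coordinates for a partial cube *)

Lemma dist_hypercube n (a b : hypercube n) : dist adj a b = #|sep a b|.
Proof.
apply: (@dist_sep n _ _ id) => // {a b} [a b /eqP //|a b neq_ab].
have /set0Pn[i iab] : sep a b != set0.
  by apply: contra_neq neq_ab => /sep_eq0.
exists [ffun j => if j == i then b j else a j].
  apply/eqP; rewrite -(cards1 i); apply: eq_card => j; rewrite !inE ffunE.
  by case: (eqVneq j i) => [->|_]; [move: iab; rewrite inE | rewrite eqxx].
rewrite [ltnRHS](cardsD1 i) iab ltnS; apply: subset_leq_card.
apply/subsetP => j; rewrite !inE ffunE.
by case: (j == i); rewrite ?eqxx.
Qed.

Definition cube_embedding (G : sgraph) n (phi : G -> {ffun 'I_n -> bool}) :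
    Prop :=
  [/\ injective phi,
      forall x y, adj x y -> #|sep (phi x) (phi y)| = 1 &
      forall x y, dist adj x y = #|sep (phi x) (phi y)|].

Lemma partial_cube_embedding (G : sgraph) : connected G -> partial_cube G ->
  exists n (phi : G -> {ffun 'I_n -> bool}), cube_embedding phi.
Proof.
move=> conG [n [S [a [[_ a_adj a_dist] [f [[g fK gK] f_adj]]]]]].
pose phi x : {ffun 'I_n -> bool} := val (f x).
have phi_inj : injective phi by move=> x y /val_inj; apply: can_inj fK _ _.
have sep1 x y : adj x y -> #|sep (phi x) (phi y)| = 1.
  by rewrite -f_adj => /a_adj/eqP.
exists n, phi; split=> //; apply: dist_sep => // x y neq_xy.
have cxy : connect a (f x) (f y).
  have /connectP[p ep ->] := conG x y; apply/connectP.
  exists (map f p); last by rewrite last_map.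
  by rewrite path_map; apply: sub_path ep => u v; rewrite /= f_adj.
(* The closer neighbour is the first step of a geodesic in the isometric subgraph. *)
have [[|u p] /= [ep lp sp]] := dist_path cxy.
  by move/(can_inj fK): lp neq_xy => ->; rewrite eqxx.
case/andP: ep => xu up; exists (g u); first by rewrite -f_adj gK.
rewrite /phi gK -!dist_hypercube -!a_dist -sp ltnS -lp.
exact: dist_le_size.
Qed.

(** * Sums over ordered pairs *)

Lemma N1C (H : sgraph) (x y : H) : N1 (y, x) = N2 (x, y). Proof. by []. Qed.
Lemma N2C (H : sgraph) (x y : H) : N2 (y, x) = N1 (x, y). Proof. by []. Qed.

Section OrientedSums.
Variables (R : numDomainType) (H : sgraph).
Local Open Scope ring_scope.

Lemma sum_oriented_edges (h : H * H -> R) :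
  (forall x y, h (y, x) = h (x, y)) ->
  \sum_(e : H * H | adj e.1 e.2) h e = 2 * \sum_(e in oriented_edges H) h e.
Proof.
move=> hC; rewrite (bigID (mem (oriented_edges H))) /= mulr2n mulrDl mul1r.
congr (_ + _); first by apply: eq_bigl => e; rewrite inE andbA andbb.
have swapK : involutive (fun e : H * H => (e.2, e.1)) by case.
rewrite (reindex_inj (inv_inj swapK)) /=.
apply: eq_big => [[x y]|[x y] _]; last exact: hC.
rewrite !inE /= adj_sym; case xy: (adj x y) => //=.
rewrite -leqNgt leq_eqVlt orb_idl // => /eqP/val_inj/enum_rank_inj eq_xy.
by rewrite eq_xy adj_irrefl in xy.
Qed.

Lemma double_wSz (w : H -> R) (w' : {set H} -> R) :
  2 * wSz w w' = \sum_(e : H * H | adj e.1 e.2)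
    w' [set e.1; e.2] * (\sum_(z in N1 e) w z) * (\sum_(z in N2 e) w z).
Proof.
rewrite -sum_oriented_edges // => x y.
by rewrite (N1C x y) (N2C x y) (setUC [set y]) mulrAC.
Qed.

End OrientedSums.

Lemma set2_adj (H : sgraph) (u v a b : H) : adj u v ->
  [set u; v] = [set a; b] -> (u = a /\ v = b) \/ (u = b /\ v = a).
Proof.
move=> uv uvab; have neq_uv : u != v.
  by apply: contraTneq uv => ->; rewrite adj_irrefl.
have : u \in [set a; b] by rewrite -uvab set21.
have : v \in [set a; b] by rewrite -uvab set22.
by rewrite !inE => /orP[] /eqP va /orP[] /eqP ua; subst; auto;
  rewrite eqxx in neq_uv.
Qed.

(** * The relation Theta in coordinates *)

Section Embedded.
Variables (G : sgraph) (n : nat) (phi : G -> {ffun 'I_n -> bool}).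
Hypothesis phi_emb : cube_embedding phi.

Let D x y := sep (phi x) (phi y).

Lemma adj_sep x y : adj x y -> exists i, D x y = [set i].
Proof. by case: phi_emb => _ sep1 _ /sep1/eqP/cards1P. Qed.

(** Take z next on a geodesic to y. As [D z y] is smaller than [D x y] and differs from it at most
    at i, the step must remove i. *)
Lemma closer_neighbour x y : connected G -> x != y ->
  exists z i, [/\ adj x z, D x z = [set i], i \in D x y & D z y = D x y :\ i].
Proof.
case: phi_emb => _ _ dphi conG neq_xy.
have [[|z p] /= [ep lp sp]] := dist_path (conG x y).
  by rewrite lp eqxx in neq_xy.
case/andP: ep => xz zp; have [i Dxz] := adj_sep xz; exists z, i.
have lt_z : #|D z y| < #|D x y| by rewrite /D -!dphi -sp -lp ltnS dist_le_size.
have iP j : (phi x j != phi z j) = (j == i).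
  by move/setP/(_ j): Dxz; rewrite !inE.
have Dzy : D z y :\ i = D x y :\ i.
  apply/setP => j; rewrite !inE -iP.
  by case: (phi x j) (phi y j) (phi z j) => [] [] [].
move: lt_z; rewrite (cardsD1 i (D z y)) Dzy (cardsD1 i (D x y)) ltn_add2r.
case iz: (i \in D z y); case ix: (i \in D x y) => // _; split=> //.
rewrite -Dzy; apply/setP => j; rewrite in_setD1.
by case: eqP => // ->; rewrite iz.
Qed.

(** Let j be the coordinate flipped by xy. Off j, the distances to x and to y agree and cancel; at
    j, the two sums differ exactly when uv also flips j. *)
Lemma dist_square x y u v : adj u v -> adj x y ->
  (dist adj u x + dist adj v y != dist adj u y + dist adj v x) =
  (D u v == D x y).
Proof.
case: phi_emb => _ _ dphi uv xy.
have [i Duv] := adj_sep uv; have [j Dxy] := adj_sep xy.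
have Dj w : D w y :\ j = D w x :\ j.
  apply/setP => k; have := in_set1 j k; rewrite -Dxy !inE.
  by case: (k == j) (phi x k) (phi y k) (phi w k) => [] [] [] [].
rewrite !dphi !(cardsD1 j (sep _ _)) -!/(D _ _) !Dj.
rewrite addnACA [X in _ != X]addnACA eqn_add2r.
have -> : (D u v == D x y) = (j \in D u v).
  by rewrite Duv Dxy (inj_eq set1_inj) inE eq_sym.
have : j \in D x y by rewrite Dxy set11.
rewrite !inE.
by case: (phi x j) (phi y j) (phi u j) (phi v j) => [] [] [] [].
Qed.

Lemma Theta_sep u v x y : adj u v -> adj x y ->
  Theta [set u; v] [set x; y] = (D u v == D x y).
Proof.
move=> uv xy; apply/existsP/idP => [[u1]|Duv].
  case/existsP=> v1 /existsP[x1 /existsP[y1 /and3P[/eqP uvE /eqP xyE]]].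
  case: (set2_adj uv uvE) => -[<- <-]; case: (set2_adj xy xyE) => -[<- <-];
  rewrite dist_square // 1?adj_sym //;
  by move: (sepC (phi u) (phi v)) (sepC (phi x) (phi y)); rewrite /D => -> ->.
exists u; apply/existsP; exists v; apply/existsP; exists x.
by apply/existsP; exists y; rewrite !eqxx dist_square.
Qed.

(** * Components of G - F and the metric of G/F *)

Section Class.
Variable F : {set {set G}}.
Hypothesis conG : connected G.
(** Closure of F under Theta, phrased in coordinates. *)
Hypothesis F_sep : forall u v x y, [set u; v] \in F -> adj u v -> adj x y ->
  D u v = D x y -> [set x; y] \in F.

Local Notation q := (quotient_graph F).

Definition class_coords : {set 'I_n} :=
  [set i | [exists x, exists y, [&& adj x y, [set x; y] \in F & i \in D x y]]].
Let I := class_coords.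

Lemma mem_class x y i : adj x y -> D x y = [set i] ->
  ([set x; y] \in F) = (i \in I).
Proof.
move=> xy Dxy; apply/idP/idP => [xyF|].
  rewrite inE; apply/existsP; exists x; apply/existsP; exists y.
  by rewrite xy xyF Dxy set11.
rewrite inE => /existsP[u /existsP[v /and3P[uv uvF]]].
have [j Duv] := adj_sep uv; rewrite Duv inE => /eqP ij.
by apply: F_sep uvF uv xy _; rewrite Duv Dxy ij.
Qed.

Lemma del_edges_connect_sym : connect_sym (del_edges F).
Proof.
by apply: sym_connect_sym => u v; rewrite /del_edges adj_sym setUC.
Qed.

(** Edges outside F flip no coordinate of I. Conversely, a geodesic from x to y flips only
    coordinates of [D x y]; if these avoid I, it uses no edge of F. *)
Lemma connect_del_edges x y : connect (del_edges F) x y = [disjoint D x y & I].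
Proof.
apply/idP/idP => [/connectP[p ep ->]|].
  elim: p x ep => [|z p IHp] x /=.
    by rewrite /D sepxx -setI_eq0 set0I.
  case/andP=> /andP[xz xzF] /IHp dz; have [i Dxz] := adj_sep xz.
  apply: disjointWl (sep_triangle (phi z) _ _) _.
  rewrite -setI_eq0 setIUl setU_eq0 !setI_eq0 dz andbT -/(D x z) Dxz.
  by rewrite disjoints1 -(mem_class xz Dxz).
have [m] := ubnP #|D x y|; elim: m x => // m IHm x lt_m dis.
have [->|neq_xy] := eqVneq x y; first exact: connect0.
have [z [i [xz Dxz iD Dzy]]] := closer_neighbour conG neq_xy.
have iI : i \notin I by rewrite (disjointFr dis).
apply: connect_trans (connect1 _) (IHm z _ _).
- by rewrite /del_edges xz (mem_class xz Dxz).
- by rewrite Dzy; move: lt_m; rewrite (cardsD1 i) iD ltnS.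
- by rewrite Dzy; apply: disjointWl dis; apply: subD1set.
Qed.

Lemma cpnt_subproof x :
  [set y in [set: G] | connect (del_edges F) x y] \in components F.
Proof. exact: imset_f. Qed.

Definition cpnt x : q :=
  exist (fun X => X \in components F) _ (cpnt_subproof x).

Lemma mem_cpnt x y : (y \in val (cpnt x)) = connect (del_edges F) x y.
Proof. by rewrite !inE. Qed.

Lemma cpnt_eq x y : (cpnt x == cpnt y) = [disjoint D x y & I].
Proof.
rewrite -connect_del_edges; apply/eqP/idP => [eq_xy|cxy].
  by rewrite -mem_cpnt eq_xy mem_cpnt connect0.
apply/val_inj/setP => z; rewrite !mem_cpnt.
exact: (same_connect del_edges_connect_sym).
Qed.

Lemma cpnt_surj (X : q) : exists x, X = cpnt x.
Proof.
by case: X => X XP; case/imsetP: (XP) => x _ eqX; exists x; apply/val_inj.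
Qed.

Lemma in_cpnt (X : q) x : (x \in val X) = (cpnt x == X).
Proof.
have [y ->] := cpnt_surj X.
by rewrite mem_cpnt cpnt_eq connect_del_edges /D sepC.
Qed.

Lemma quot_adjP (X Y : q) :
  reflect (exists x y, [/\ adj x y, cpnt x = X, cpnt y = Y & X != Y]) (adj X Y).
Proof.
apply: (iffP andP) => [[neqXY /exists_inP[x xX /exists_inP[y yY xy]]]|].
  by exists x, y; split=> //; apply/eqP; rewrite -in_cpnt.
case=> x [y [xy eX eY neqXY]]; split=> //; apply/exists_inP.
exists x; first by rewrite in_cpnt eX.
by apply/exists_inP; exists y; rewrite // in_cpnt eY.
Qed.

Lemma cpnt_adj x y : adj x y -> adj (cpnt x) (cpnt y) = ([set x; y] \in F).
Proof.
move=> xy; have [i Dxy] := adj_sep xy; rewrite (mem_class xy Dxy).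
have neqE : (cpnt x != cpnt y) = (i \in I).
  by rewrite cpnt_eq Dxy disjoints1 negbK.
apply/quot_adjP/idP => [[u [v [_ _ _]]]|iI]; first by rewrite neqE.
by exists x, y; rewrite neqE.
Qed.

(** Coordinates in I are constant on a component, so the existential reads off their common value.
    The others are set to false, which keeps the target an n-cube. *)
Definition quot_embedding (X : q) : {ffun 'I_n -> bool} :=
  [ffun i => (i \in I) && [exists x in val X, phi x i]].
Let psi := quot_embedding.

Lemma quot_embedding_cpnt x i : psi (cpnt x) i = (i \in I) && phi x i.
Proof.
rewrite ffunE; case iI: (i \in I); last by [].
rewrite !andTb; apply/exists_inP/idP => [[y]|xi].
  rewrite in_cpnt cpnt_eq => dis yi; have := disjointFl dis iI.
  by rewrite inE yi => /negbFE/eqP <-.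
by exists x; rewrite // mem_cpnt connect0.
Qed.

Lemma sep_quot_embedding x y : sep (psi (cpnt x)) (psi (cpnt y)) = D x y :&: I.
Proof.
apply/setP => i; rewrite in_setI 2![i \in sep _ _]inE !quot_embedding_cpnt.
by case: (i \in I); rewrite ?andbT ?andbF.
Qed.

Lemma dist_quot (X Y : q) : dist adj X Y = #|sep (psi X) (psi Y)|.
Proof.
apply: dist_sep => {X Y} [X Y|X Y|X Y].
- have [x ->] := cpnt_surj X; have [y ->] := cpnt_surj Y => eq_psi.
  apply/eqP; rewrite cpnt_eq -setI_eq0 -sep_quot_embedding eq_psi.
  by rewrite sepxx.
- case/quot_adjP=> x [y [xy <- <-]]; rewrite cpnt_eq sep_quot_embedding.
  have [i ->] := adj_sep xy; rewrite disjoints1 negbK => iI.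
  by rewrite (setIidPl _) ?cards1 ?sub1set.
have [x ->] := cpnt_surj X; have [y ->] := cpnt_surj Y.
have [m] := ubnP #|D x y|; elim: m x => // m IHm x lt_m neq_xy.
have neq_xy' : x != y by apply: contra_neq neq_xy => ->.
have [z [i [xz Dxz iD Dzy]]] := closer_neighbour conG neq_xy'.
(* A step flipping a coordinate of I is an edge of G/F leading closer. Any other step stays in the
   component, and the search continues from z. *)
have [iI|niI] := boolP (i \in I).
  exists (cpnt z); first by rewrite cpnt_adj // (mem_class xz Dxz).
  rewrite !sep_quot_embedding Dzy [ltnRHS](cardsD1 i) inE iD iI ltnS.
  by rewrite setIDAC.
have exz : cpnt x = cpnt z by apply/eqP; rewrite cpnt_eq Dxz disjoints1.
rewrite exz; apply: IHm; last by rewrite -exz.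
by rewrite Dzy; move: lt_m; rewrite (cardsD1 i) iD ltnS.
Qed.

(** Both memberships say that z agrees with x at the coordinate i flipped by xy, which the
    projection keeps since i is in I. *)
Lemma mem_N1_cpnt x y z : adj x y -> [set x; y] \in F ->
  (cpnt z \in N1 (cpnt x, cpnt y)) = (z \in N1 (x, y)).
Proof.
case: phi_emb => _ _ dphi xy; have [i Dxy] := adj_sep xy.
rewrite (mem_class xy Dxy) => iI; rewrite !inE /= !dist_quot !dphi.
rewrite (ltn_card_sep _ Dxy) (@ltn_card_sep _ _ _ _ i); last first.
  by rewrite sep_quot_embedding Dxy (setIidPl _) ?sub1set.
by rewrite !quot_embedding_cpnt iI.
Qed.

(** * Weights of G/F as counts in G *)

Section Weights.
Variable R : numDomainType.
Local Open Scope ring_scope.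

(** By [mem_N1_cpnt], [N1 (x, y)] is the disjoint union of the components counted on the left. *)
Lemma sum_vweight_N1 x y : adj x y -> [set x; y] \in F ->
  \sum_(Z in N1 (cpnt x, cpnt y)) quot_vweight R Z = (#|N1 (x, y)|)%:R.
Proof.
move=> xy xyF; rewrite -sum1_card natr_sum.
rewrite (partition_big cpnt (mem (N1 (cpnt x, cpnt y)))) /=; last first.
  by move=> z; rewrite (mem_N1_cpnt _ xy xyF).
apply: eq_bigr => Z ZN; rewrite /quot_vweight -sum1_card natr_sum.
apply: eq_bigl => z; rewrite in_cpnt andb_idl // => /eqP zZ.
by rewrite -(mem_N1_cpnt _ xy xyF) zZ.
Qed.

Lemma sum_vweight_N2 x y : adj x y -> [set x; y] \in F ->
  \sum_(Z in N2 (cpnt x, cpnt y)) quot_vweight R Z = (#|N2 (x, y)|)%:R.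
Proof. by rewrite adj_sym setUC -!N1C; apply: sum_vweight_N1. Qed.

(* The ends of a quotient edge are disjoint, so each edge between them is     *)
(* counted by exactly one ordered pair.                                       *)
Lemma eweight_pairs (X Y : q) : F \subset edges G -> adj X Y ->
  quot_eweight R [set X; Y] =
    (#|[set e : G * G | adj e.1 e.2 && (cpnt e.1 == X) && (cpnt e.2 == Y)]|)%:R.
Proof.
move=> FE XY; congr _%:R.
have neqXY : X != Y by case/andP: XY.
set A := (X in _ = #|pred_of_set X|).
rewrite -(@card_in_imset _ _ (fun e : G * G => [set e.1; e.2]) A).
  apply: eq_card => f; rewrite inE; apply/andP/imsetP => [[fF]|].
    case/existsP=> X' /existsP[Y' /andP[/eqP XYE]].
    case/exists_inP=> x xX /exists_inP[y yY /eqP fE].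
    have xy : adj x y.
      have /imsetP[[a b]] := subsetP FE f fF; rewrite inE /= => ab.
      by rewrite fE => /esym/(set2_adj ab)[] [<- <-] //; rewrite adj_sym.
    move: xX yY; rewrite !in_cpnt; case: (set2_adj XY XYE) => -[<- <-] xX yY.
      by exists (x, y); rewrite // inE xy xX yY.
    by exists (y, x); rewrite ?inE /= 1?adj_sym ?xy ?xX ?yY // setUC.
  case=> -[x y]; rewrite inE /= => /andP[/andP[xy /eqP xX] /eqP yY] ->.
  split; first by rewrite -cpnt_adj // xX yY.
  apply/existsP; exists X; apply/existsP; exists Y; rewrite eqxx /=.
  apply/exists_inP; exists x; first by rewrite in_cpnt xX.
  by apply/exists_inP; exists y; rewrite // in_cpnt yY.
move=> [x y] [x' y']; rewrite !inE /=.
move=> /andP[/andP[xy /eqP xX] /eqP yY] /andP[/andP[xy' /eqP xX'] /eqP yY'].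
case/(set2_adj xy) => -[xE yE]; first by rewrite xE yE.
by case/eqP: neqXY; rewrite -xX -yY' xE.
Qed.

(** Oriented edges of F are grouped by the ordered pair of components they join. Each group has as
    many members as the edge weight, all with the same product of half sizes. *)
Lemma double_wSz_quot : F \subset edges G ->
  2 * wSz (@quot_vweight G F R) (@quot_eweight G F R) =
  \sum_(e : G * G | adj e.1 e.2 && ([set e.1; e.2] \in F))
     (#|N1 e| * #|N2 e|)%:R.
Proof.
move=> FE; rewrite double_wSz.
rewrite [RHS](partition_big (fun e : G * G => (cpnt e.1, cpnt e.2))
  (fun E : q * q => adj E.1 E.2)); last first.
  by move=> e /andP[xy]; rewrite cpnt_adj.
apply: eq_bigr => -[X Y] XY; rewrite eweight_pairs // -mulrA.
rewrite -sum1_card natr_sum mulr_suml.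
apply: eq_big => [[x y]|[x y]].
  rewrite inE /= xpair_eqE -!andbA; case xy: (adj x y) => //=.
  apply/idP/idP => [/andP[/eqP eX /eqP eY]|/and3P[_ -> ->] //].
  by rewrite -cpnt_adj // eX eY !eqxx XY.
rewrite inE => /andP[/andP[xy /eqP eX] /eqP eY]; simpl in xy, eX, eY.
have xyF : [set x; y] \in F by rewrite -cpnt_adj // eX eY.
have nN1 := sum_vweight_N1 xy xyF.
have nN2 := sum_vweight_N2 xy xyF.
rewrite eX eY in nN1 nN2.
by rewrite mul1r natrM -nN1 -nN2.
Qed.

End Weights.
End Class.
End Embedded.

(** * Summing over the blocks *)

Theorem theorem3p4 (R : realFieldType) (G : sgraph)
    (P : {set {set {set G}}}) :
  connected G -> partial_cube G ->
  partition P (edges G) -> coarser P ->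
  ((Sz G)%:R =
     \sum_(F in P) wSz (@quot_vweight G F R) (@quot_eweight G F R) :> R)%R.
Proof.
move=> conG pcG partP coaP.
have [n [phi phi_emb]] := partial_cube_embedding conG pcG.
have [/eqP coverP trivP _] := and3P partP.
have two_neq0 : (2 : R)%R != 0%R by rewrite pnatr_eq0.
apply: (mulfI two_neq0); rewrite mulr_sumr natr_sum.
rewrite -sum_oriented_edges; last first.
  by move=> x y; rewrite N1C N2C mulnC.
(* Each oriented edge is assigned to the unique block containing it. *)
rewrite (partition_big (fun e : G * G => pblock P [set e.1; e.2]) (mem P)) /=.
  apply: eq_bigr => F FP; rewrite (double_wSz_quot phi_emb conG).
  - apply: eq_bigl => -[x y] /=; case xy: (adj x y) => //=.
    apply/eqP/idP => [<-|xyF]; last exact: def_pblock.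
    by rewrite mem_pblock coverP; apply/imsetP; exists (x, y); rewrite ?inE.
  - move=> u v x y uvF uv xy Duv.
    (* F is a union of Theta-classes; the class B containing uv also contains xy, which flips the
       same coordinate. *)
    have [C CP FE] := coaP F FP.
    move: uvF; rewrite FE => /bigcupP[B BC uvB]; apply/bigcupP; exists B => //.
    have /imsetP[f fE BE] := subsetP CP B BC.
    case/imsetP: fE BE => -[a b]; rewrite inE /= => ab -> BE.
    move: uvB; rewrite BE !inE => /andP[_]; rewrite !(Theta_sep phi_emb) //.
    rewrite Duv => ->; rewrite andbT.
    by apply/imsetP; exists (x, y); rewrite ?inE.
  - by rewrite -coverP; apply: (bigcup_sup F).
move=> -[x y] /= xy; apply: pblock_mem; rewrite coverP.
by apply/imsetP; exists (x, y); rewrite ?inE.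
Qed.
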